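(* Let $n\ge 2$ and let $s=(s_1,s_2,\dots,s_n)\in\{0,1\}^n$ with $s_1=s_2$. Let $G$ be the threshold graph with creation sequence $s$: the simple graph (no self-loops) on $\{1,\dots,n\}$ in which, for $i<j$, the vertices $i$ and $j$ are adjacent if and only if $s_j=1$. Write $s$ uniquely in run form \[ s=(\underbrace{1,\dots,1}_{k_1},\underbrace{0,\dots,0}_{l_1},\underbrace{1,\dots,1}_{k_2},\underbrace{0,\dots,0}_{l_2},\dots,\underbrace{1,\dots,1}_{k_m},\underbrace{0,\dots,0}_{l_m}), \] where $m\ge1$, $k_1,l_m\ge 0$ and $k_2,\dots,k_m,l_1,\dots,l_{m-1}\ge1$ (so either $s_1=1$ and $k_1\ge2$, or $s_1=0$, $k_1=0$ and $l_1\ge2$). Set \[ C_n(-1)=\sum_{i=1}^m k_i-(m-1)-I_{\{1\}}(s_1),\qquad C_n(0)=\sum_{i=1}^m l_i-(m-1),\qquad J=2(m-1)+I_{\{1\}}(s_1). \] Define the sequence $(a_1,\dots,a_J)$ by $a_{2r-1}=k_{m-r+1}$ and $a_{2r}=l_{m-r}$ for all indices in $\{1,\dots,J\}$; thus $(a_1,\dots,a_J)=(k_m,l_{m-1},k_{m-1},l_{m-2},\dots,l_1,k_1)$ if $s_1=1$ and $(a_1,\dots,a_J)=(k_m,l_{m-1},k_{m-1},\dots,k_2,l_1)$ if $s_1=0$. Let $B$ be the $J\times J$ matrix with entries: for odd $p$, $B_{pq}=a_q$ if $q>p$, $B_{pp}=a_p-1$, and for $q<p$, $B_{pq}=a_q$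 if $q$ is odd and $B_{pq}=0$ if $q$ is even; for even $p$, $B_{pq}=a_q$ if $q<p$ and $q$ is odd, and $B_{pq}=0$ otherwise. Let $\lambda_1,\dots,\lambda_J$ be the eigenvalues of $B$ counted with algebraic multiplicity. Then the spectral distribution of $G$ is \[ \mu_n(G)=\frac{C_n(-1)}{n}\,\delta_{-1}+\frac{C_n(0)}{n}\,\delta_0+\frac1n\sum_{j=1}^J\delta_{\lambda_j}, \] and moreover every $\lambda_j$ is different from $0$ and from $-1$.
   Context: The spectral distribution of a graph $G$ on $n$ vertices is the probability measure $\mu_n(G)=\frac1n\sum_{i=1}^n\delta_{\mu_i}$, where $\mu_1,\dots,\mu_n$ are the eigenvalues (with multiplicity) of the adjacency matrix of $G$; $\delta_x$ is the Dirac measure at $x$ and $I_{\{1\}}(s_1)$ equals $1$ if $s_1=1$ and $0$ otherwise. *)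

(* Defs.v *)
From HB Require Import structures.
From mathcomp Require Import all_boot all_order all_algebra.
From mathcomp Require Import complex.
From mathcomp Require Import all_classical all_reals all_analysis.

Set Implicit Arguments.
Unset Strict Implicit.
Unset Printing Implicit Defensive.

Import Order.TTheory GRing.Theory Num.Theory.
Import numFieldNormedType.Exports.

Local Open Scope ring_scope.

Section Eigenvalues.
Variable R : realType.

Lemma eigenvalues_subproof n (M : 'M[R]_n) :
  {t : n.-tuple R[i] |
     map_poly (real_complex R) (char_poly M) = \prod_(z <- t) ('X - z%:P)}.
Proof.
set p := map_poly _ _.
have mp : p \is monic by rewrite map_monic char_poly_monic.
have sp : size p = n.+1.
  by rewrite (size_map_poly_id0 _) ?size_char_poly // (eqP (char_poly_monic M))
     rmorph1 oner_eq0.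
case: (closed_field_poly_normal p) => r.
rewrite (eqP mp) scale1r => pE.
have rn : size r == n.
  by have := size_prod_XsubC r id; rewrite -pE sp => -[<-].
by exists (Tuple rn).
Qed.

(* The n complex eigenvalues of a real matrix, repeated according to their
   algebraic multiplicity and listed in an arbitrary order. *)
Definition eigenvalues n (M : 'M[R]_n) : n.-tuple R[i] :=
  sval (eigenvalues_subproof M).

Lemma eigenvaluesP n (M : 'M[R]_n) :
  map_poly (real_complex R) (char_poly M) =
  \prod_(z <- eigenvalues M) ('X - z%:P).
Proof. exact: svalP (eigenvalues_subproof M). Qed.

Lemma symmetric_eigenvalues_real n (M : 'M[R]_n) (j : 'I_n) :
  M^T = M -> tnth (eigenvalues M) j \is Num.real.
Proof.
move=> Msym; set z := tnth _ j; set A := map_mx (real_complex R) M.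
have AE : char_poly A = \prod_(z <- eigenvalues M) ('X - z%:P).
  by rewrite -eigenvaluesP -map_char_poly.
have : eigenvalue A z by rewrite eigenvalue_root_char AE root_prod_XsubC mem_tnth.
have Aherm : A \is hermsymmx.
  apply: realsym_hermsym.
    by apply/is_hermitianmxP; rewrite expr0 scale1r map_mx_id // map_trmx Msym.
  by apply/mxOverP => a b; rewrite mxE complex_real.
case/eigenvalueP => v vA v0.
have /orthomx_spectralP Adiag := hermitian_normalmx Aherm.
set P := spectralmx A in Adiag; set d := spectral_diag A in Adiag.
have PU : P \in unitmx by exact: spectral_unit.
pose w := v *m invmx P.
have wd : w *m diag_mx d = z *: w.
  by rewrite /w scalemxAl -vA [in RHS]Adiag !mulmxA mulmxK.
have w0 : w != 0.
  apply: contraNneq v0 => w0.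
  by rewrite -[v](mulmxKV PU) -/w w0 mul0mx.
have [i wi] : exists i, w 0 i != 0.
  by case/rV0Pn: w0 => i; exists i.
have : (w *m diag_mx d) 0 i = (z *: w) 0 i by rewrite wd.
rewrite mul_mx_diag [LHS]mxE [RHS]mxE [RHS]mulrC => /(mulfI wi) <-.
exact/mxOverP/hermitian_spectral_diag_real.
Qed.

End Eigenvalues.

Record sgraph (n : nat) := SGraph {
  adj :> rel 'I_n;
  adj_sym : symmetric adj;
  adj_irr : irreflexive adj
}.

Section SpectralDistribution.
Variable R : realType.

Definition adjacency n (G : sgraph n) : 'M[R]_n := \matrix_(i, j) (G i j)%:R.

Lemma adjacency_eigenvalues_real n (G : sgraph n) (j : 'I_n) :
  tnth (eigenvalues (adjacency G)) j \is Num.real.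
Proof.
apply: symmetric_eigenvalues_real.
by apply/matrixP => a b; rewrite !mxE adj_sym.
Qed.

(* Taking the real part only moves the eigenvalues from R[i] to R: they are
   real by adjacency_eigenvalues_real. *)
Definition spectral_distribution n (G : sgraph n) : {measure set R -> \bar R} :=
  mscale (n%:R^-1 : R)%:nng
    (msum (fun i => \d_(complex.Re (nth 0 (eigenvalues (adjacency G)) i))) n).

Lemma spectral_distribution_setT n (G : sgraph n) :
  (0 < n)%N -> spectral_distribution G [set: R]%classic = 1%E.
Proof.
move=> n0; rewrite /spectral_distribution /= /mscale /= /msum.
rewrite (eq_bigr (fun=> 1%:E)) => [|i _]; last by rewrite /= diracE in_setT.
by rewrite sumEFin sumr_const card_ord -EFinM mulVf // pnatr_eq0 -lt0n.
Qed.

End SpectralDistribution.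

(* The vertices 1, ..., n and the letters s_1, ..., s_n are numbered from 0
   here: s_(i+1) is tnth s i. *)
Definition threshold_rel n (s : n.-tuple bool) : rel 'I_n :=
  fun i j => (i < j)%N && tnth s j || (j < i)%N && tnth s i.

Lemma threshold_rel_sym n (s : n.-tuple bool) : symmetric (threshold_rel s).
Proof. by move=> i j; rewrite /threshold_rel orbC. Qed.

Lemma threshold_rel_irr n (s : n.-tuple bool) : irreflexive (threshold_rel s).
Proof. by move=> i; rewrite /threshold_rel ltnn. Qed.

Definition threshold_graph n (s : n.-tuple bool) : sgraph n :=
  SGraph (threshold_rel_sym s) (threshold_rel_irr s).

(* Only the values k 1, ..., k m and l 1, ..., l m are used. *)
Definition run_form (s : seq bool) (m : nat) (k l : nat -> nat) : Prop :=
  [/\ (1 <= m)%N,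
      forall i, (2 <= i <= m)%N -> (1 <= k i)%N,
      forall i, (1 <= i < m)%N -> (1 <= l i)%N
    & s = flatten [seq nseq (k i) true ++ nseq (l i) false | i <- iota 1 m]].

Lemma run_form_exists (s : seq bool) : exists m k l, run_form s m k l.
Proof.
elim/last_ind: s => [|s b [m [k [l [m1 k1 l1 sE]]]]].
  exists 1%N, (fun=> 0%N), (fun=> 0%N); split => // i.
    by case/andP => /leq_trans h /h.
  by case/andP => /leq_trans h /h.
have iotaE (j : nat) : iota 1 j.+1 = iota 1 j ++ [:: j.+1].
  by rewrite -[X in iota 1 X]addn1 iotaD add1n.
case: m m1 k1 l1 sE => // m _ k1 l1 sE.
have eqm (f g : nat -> seq bool) j :
    (forall i, (1 <= i <= j)%N -> f i = g i) ->
    [seq f i | i <- iota 1 j] = [seq g i | i <- iota 1 j].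
  by move=> fg; apply/eq_in_map => i; rewrite mem_iota add1n ltnS => /fg.
have Dm j (i : nat) : (1 <= i <= j)%N -> (i == j.+1) = false.
  by case/andP => _ ij; apply/negbTE; rewrite neq_ltn ltnS ij.
case: b; last first.
  exists m.+1, k, (fun i => if i == m.+1 then (l i).+1 else l i); split => //.
    by move=> i /l1; case: ifP.
  rewrite sE iotaE !map_cat !flatten_cat /= eqxx !cats0 rcons_cat; congr (_ ++ _).
    by congr flatten; apply: eqm => i /Dm ->.
  by rewrite rcons_cat -[(l m.+1).+1]addn1 nseqD cats1.
case: (posnP (l m.+1)) => [l0|lp].
  exists m.+1, (fun i => if i == m.+1 then (k i).+1 else k i), l; split => //.
    by move=> i /k1; case: ifP.
  rewrite sE iotaE !map_cat !flatten_cat /= eqxx !cats0 rcons_cat; congr (_ ++ _).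
    by congr flatten; apply: eqm => i /Dm ->.
  by rewrite l0 ?cats0 -[(k m.+1).+1]addn1 nseqD -cats1.
exists m.+2, (fun i => if i == m.+2 then 1%N else k i),
  (fun i => if i == m.+2 then 0%N else l i); split => //.
- move=> i /andP[i2 im]; case: eqP => // /eqP im2; apply: k1.
  by rewrite i2 -ltnS ltn_neqAle im2.
- move=> i /andP[i1 im]; rewrite ltn_eqF //.
  have [->//|im'] := eqVneq i m.+1.
  by apply: l1; rewrite i1 ltn_neqAle im'.
rewrite sE (iotaE m.+1) map_cat flatten_cat -cats1; congr (_ ++ _); last first.
  by rewrite /= eqxx.
by congr flatten; apply: eqm => i /Dm ->.
Qed.

Section BlockMatrix.
Variables (m : nat) (k l : nat -> nat).

(* I_{1}(s_1) *)
Definition I_s1 (s : seq bool) : nat := nth false s 0.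

Definition C_m1 (s : seq bool) : int :=
  (\sum_(1 <= i < m.+1) k i)%N%:Z - (m%:Z - 1) - (I_s1 s)%:Z.

Definition C_0 : int := (\sum_(1 <= i < m.+1) l i)%N%:Z - (m%:Z - 1).

Definition J_dim (s : seq bool) : nat := (2 * (m - 1) + I_s1 s)%N.

(* a_p for p >= 1: a_(2r-1) = k_(m-r+1) and a_(2r) = l_(m-r). *)
Definition a_seq (p : nat) : nat :=
  if odd p then k (m - (p.+1)./2 + 1) else l (m - p./2).

Definition B_entry (R : pzRingType) (p q : nat) : R :=
  let a := a_seq in
  if odd p then
    if (p < q)%N then (a q)%:R
    else if q == p then (a p)%:R - 1
    else if odd q then (a q)%:R else 0
  else if (q < p)%N && odd q then (a q)%:R else 0.

(* Entries are indexed from 1. *)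
Definition B_mx (R : pzRingType) (J : nat) : 'M[R]_J :=
  \matrix_(p < J, q < J) B_entry R p.+1 q.+1.

End BlockMatrix.

(* Main.v *)
Require Import Defs.
From HB Require Import structures.
From mathcomp Require Import all_boot all_order all_algebra.
From mathcomp Require Import complex.
From mathcomp Require Import all_classical all_reals all_analysis.
From mathcomp Require Import zify ring lra.

Set Implicit Arguments.
Unset Strict Implicit.
Unset Printing Implicit Defensive.

Import Order.TTheory GRing.Theory Num.Theory.
Import numFieldNormedType.Exports.

Local Open Scope ring_scope.

(** Label a vertex of the [i]-th run of ones by [2(m-i)+1] and a vertex of the
    [i]-th run of zeros by [2(m-i)].  The labels [t] decrease along the creation
    sequence, [s_j] is the parity of [t_j], label [p] occurs [a_p] times for
    [1 <= p <= J], and label [0] marks isolated vertices.  Hence, with [P] the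
    incidence matrix of vertices and labels [1..J], and
    [C p q := odd (min p q)],
    [A + diag (odd t_i) = P C P^T]  and  [B + diag (odd p) = C (P^T P)].
    A Sylvester-type determinant identity turns this into
    [\prod_p (X + odd p) * char_poly A = \prod_i (X + s_i) * char_poly B],
    so that the eigenvalues of [A] together with the [- odd p] are the [- s_i]
    together with the eigenvalues of [B]. *)

(** * Characteristic polynomials via the label quotient *)

(* Division-free form of Sylvester's determinant identity. *)
Lemma det_sub_quotient (R : comNzRingType) n J (D : 'M[R]_n) (E C : 'M[R]_J)
    (P : 'M[R]_(n, J)) :
  P^T *m D = E *m P^T ->
  \det E * \det (D - P *m C *m P^T) = \det D * \det (E - P^T *m P *m C).
Proof.
(* Compute [\det M] twice: eliminating the block [P^T] against [1] gives a Schur complement, and a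
   left factor of determinant [\det E] replaces inverting [D]. *)
move=> PD; pose M := block_mx D (P *m C) P^T 1%:M.
have ML : M = block_mx (D - P *m C *m P^T) (P *m C) 0 1%:M *m
              block_mx 1%:M 0 P^T 1%:M.
  by rewrite mulmx_block !mulmx1 !mulmx0 mul1mx !add0r subrK.
have MR : block_mx 1%:M 0 (- P^T) E *m M
    = block_mx D (P *m C) 0 (E - P^T *m P *m C).
  rewrite mulmx_block !mul1mx !mul0mx !addr0 mulmx1 !mulNmx PD addNr.
  by rewrite mulmxA [in RHS]addrC.
have := congr1 determinant MR; rewrite det_ublock det_mulmx det_lblock ML.
by rewrite det_mulmx det_ublock det_lblock !det1 !mulr1 mul1r.
Qed.

Lemma sum_ord_eq (R : pzRingType) J (p : nat) (F : nat -> R) :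
  \sum_(q < J) (p == q.+1)%:R * F q.+1 = if (0 < p <= J)%N then F p else 0.
Proof.
case: p => [|p] /=; first by rewrite big1 // => q _; rewrite mul0r.
case: ifP => pJ.
  rewrite (bigD1 (Ordinal pJ)) //= eqxx mul1r big1 ?addr0 // => q.
  by rewrite -val_eqE /= eqSS eq_sym => /negPf ->; rewrite mul0r.
rewrite big1 // => q _; case: eqP => [[pq]|_]; last by rewrite mul0r.
by rewrite pq ltn_ord in pJ.
Qed.

(** Entrywise form of [B = C (P^T P) - diag (odd p)]. *)
Lemma B_entryE (R : pzRingType) m k l p q :
  B_entry m k l R p q
  = (odd (minn p q))%:R * (a_seq m k l q)%:R - ((p == q) && odd p)%:R.
Proof.
rewrite /B_entry /minn [q == p]eq_sym.
case: (ltngtP p q) => [pq|qp|->]; case op: (odd _);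
  rewrite /= ?subr0 ?mul1r ?mul0r ?mulr0n ?mulr1n ?subr0 //.
- by case: (odd q); rewrite ?mul1r ?mul0r.
- by case: (odd q); rewrite ?mul1r ?mul0r.
Qed.

Section Labels.
Variables (R : realType) (m : nat) (k l : nat -> nat).
Variables (n J : nat) (s : n.-tuple bool) (t : n.-tuple nat).
Hypothesis s_odd : forall i, tnth s i = odd (tnth t i).
Hypothesis t_sorted : forall i j : 'I_n, (i < j)%N -> (tnth t j <= tnth t i)%N.
Hypothesis t_le : forall i, (tnth t i <= J)%N.
Hypothesis count_t :
  forall p, (0 < p <= J)%N -> count_mem p t = a_seq m k l p.

Let P : 'M[{poly R}]_(n, J) := \matrix_(i, p) (tnth t i == p.+1)%:R.
Let C : 'M[{poly R}]_J := \matrix_(p, q) (odd (minn p.+1 q.+1))%:R.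
(** The factor [X + b], written as [X] minus its root so that products of such factors can be read
    as multisets of roots. *)
Let root_of (b : bool) : {poly R} := 'X - (- b%:R)%:P.

(** The later of two vertices has the smaller label, and its letter decides adjacency; the
    subtracted term removes the diagonal. *)
Lemma threshold_rel_label i j :
  (threshold_rel s i j)%:R = (odd (minn (tnth t i) (tnth t j)))%:R
     - ((i == j) && odd (tnth t i))%:R :> {poly R}.
Proof.
rewrite /threshold_rel !s_odd -val_eqE.
case: (ltngtP i j) => /= [ij|ji|/val_inj ->].
- by rewrite orbF subr0 (minn_idPr (t_sorted ij)).
- by rewrite subr0 (minn_idPl (t_sorted ji)).
- by rewrite minnn subrr.
Qed.

(** Label [0] has no column in [P], which is harmless because a minimum with [0] is even. *)
Lemma label_quotient i j :
  (P *m C *m P^T) i j = (odd (minn (tnth t i) (tnth t j)))%:R.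
Proof.
rewrite mxE.
transitivity (\sum_(q < J) (tnth t j == q.+1)%:R *
     (odd (minn (tnth t i) q.+1))%:R : {poly R}).
  apply: eq_bigr => q _; rewrite !mxE mulrC; congr (_ * _).
  under eq_bigr do rewrite !mxE.
  rewrite (sum_ord_eq _ _ (fun p => (odd (minn p q.+1))%:R)) t_le andbT.
  by case: posnP => // ->; rewrite min0n.
rewrite (sum_ord_eq _ _ (fun p => (odd (minn (tnth t i) p))%:R)) t_le andbT.
by case: posnP => // ->; rewrite minn0.
Qed.

Lemma label_gram p q : (P^T *m P) p q = (p == q)%:R * (a_seq m k l q.+1)%:R.
Proof.
rewrite mxE -count_t ?ltn_ord //.
under eq_bigr do rewrite !mxE.
have [->|pq] := eqVneq p q; last first.
  rewrite mul0r big1 // => i _; case: eqP => [->|]; last by rewrite mul0r.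
  by rewrite eqSS val_eqE (negPf pq) mulr0.
rewrite mul1r -sum1_count big_tuple natr_sum [RHS]big_mkcond.
by apply: eq_bigr => i _; rewrite /=; case: eqP => _; rewrite ?mul0r ?mulr1.
Qed.

Lemma threshold_char_poly :
  (\prod_(q < J) root_of (odd q.+1)) *
    char_poly (adjacency R (threshold_graph s))
  = (\prod_(i < n) root_of (tnth s i)) * char_poly (B_mx m k l R J).
Proof.
pose D := diag_mx (\row_(i < n) root_of (tnth s i)).
pose E := diag_mx (\row_(q < J) root_of (odd q.+1)).
have root_ofE b : root_of b = 'X + b%:R.
  by rewrite /root_of polyCN opprK polyC_natr.
have PD : P^T *m D = E *m P^T.
  rewrite mul_mx_diag mul_diag_mx; apply/matrixP => q i; rewrite !mxE s_odd.
  by case: eqP => [->|]; rewrite ?mulr0 ?mul0r // mulr1 mul1r.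
have := det_sub_quotient C PD; rewrite !det_diag.
under eq_bigr do rewrite mxE.
under [in X in _ = X -> _]eq_bigr do rewrite mxE.
rewrite /char_poly.
suff [<- <-]:
     D - P *m C *m P^T = char_poly_mx (adjacency R (threshold_graph s))
   (* The transpose appears because [C] and [P^T P] are symmetric but do not commute: [B] contains
      [C (P^T P)]. *)
   /\ (E - P^T *m P *m C)^T = char_poly_mx (B_mx m k l R J).
  by rewrite det_tr.
split; apply/matrixP => i j.
  rewrite mxE [X in _ + X]mxE label_quotient !mxE root_ofE polyC_natr.
  rewrite threshold_rel_label s_odd.
  by case: eqP => _; rewrite /= ?mulr0n ?mulr1n ?subr0 // opprB addrA.
rewrite mxE mxE [X in _ + X]mxE [X in - X]mxE.
under eq_bigr do rewrite label_gram -mulrA.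
rewrite (bigD1 j) //= eqxx mul1r big1 ?addr0; last first.
  by move=> p pj; rewrite eq_sym (negPf pj) mul0r.
rewrite !mxE B_entryE root_ofE polyCB polyCM !polyC_natr eqSS val_eqE.
rewrite minnC [j == i]eq_sym [_ * (a_seq _ _ _ _)%:R]mulrC.
by case: eqP => [->|_]; rewrite /= ?mulr0n ?mulr1n ?subr0 // opprB addrA.
Qed.

End Labels.

(** * Labels read off the run form *)

Definition labels m (k l : nat -> nat) : seq nat :=
  flatten [seq nseq (k i) (m - i).*2.+1 ++ nseq (l i) (m - i).*2 | i <- iota 1 m].

Lemma map_odd_labels s m k l : run_form s m k l -> map odd (labels m k l) = s.
Proof.
case=> _ _ _ ->; rewrite map_flatten -map_comp; congr flatten.
by apply: eq_map => i /=; rewrite map_cat !map_nseq /= odd_double.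
Qed.

Lemma pairwise_labels m k l : pairwise geq (labels m k l).
Proof.
pose block i := nseq (k i) (m - i).*2.+1 ++ nseq (l i) (m - i).*2.
(* Generalise to the last [c] runs, starting at run [j], and carry the upper bound needed to prepend
   a run. *)
suff H c j : (j + c <= m.+1)%N ->
    all (geq (m - j).*2.+1) (flatten (map block (iota j c))) /\
    pairwise geq (flatten (map block (iota j c))) by case: (H m 1%N).
have pairwise_nseq q x : pairwise geq (nseq q x).
  by elim: q => //= q ->; rewrite all_nseq /= leqnn orbT.
elim: c j => //= c IH j jc.
have [|ar pr] := IH j.+1; first by rewrite addSnnS.
rewrite /block !all_cat !pairwise_cat !all_nseq !pairwise_nseq /=.
rewrite leqnn leqnSn !orbT /= pr andbT.
have le_r x : x \in flatten (map block (iota j.+1 c)) -> (x <= (m - j).*2)%N.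
  case: c jc ar {IH pr} => // c jc /allP ar /ar /= /leq_trans; apply.
  by lia.
split; first by apply/allP => x /le_r /leq_trans; apply.
rewrite andbT; apply/andP; split; apply/allrelP => x y; last first.
  by rewrite !mem_nseq => /andP[_ /eqP ->] /andP[_ /eqP ->] /=.
rewrite mem_cat => xE /le_r /leq_trans; apply; move: xE.
by rewrite !mem_nseq => /orP[] /andP[_ /eqP ->].
Qed.

Lemma count_labels m k l p :
  (0 < p < m.*2)%N -> count_mem p (labels m k l) = a_seq m k l p.
Proof.
move=> /andP[p0 pm]; rewrite count_flatten sumnE !big_map /a_seq.
under eq_bigr do rewrite count_cat !count_nseq /=.
(* Label [p] can only come from run [m - p./2]; its parity selects ones or zeros. *)
rewrite (bigD1_seq (m - p./2)%N) ?iota_uniq ?mem_iota //=; last by lia.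
rewrite big1_seq ?addn0; last first.
  move=> i /andP[ip]; rewrite mem_iota => im.
  rewrite (_ : (_.+1 == p) = false) 1?(_ : (_ == p) = false) ?mul0n //; lia.
rewrite subKn; last by lia.
have -> : (p./2.*2.+1 == p) = odd p by lia.
have -> : (p./2.*2 == p) = ~~ odd p by lia.
by case: ifP => op; rewrite ?mul1n ?mul0n ?addn0 ?add0n //; congr k; lia.
Qed.

(** The first label is the largest; it is below [2m] and has the parity of [s_1], hence is at most
    [2(m-1) + I_s1 s]. *)
Lemma labels_le s m k l p :
  run_form s m k l -> p \in labels m k l -> (p <= J_dim m s)%N.
Proof.
move=> s_run; have tm x : x \in labels m k l -> (x < m.*2)%N.
  case/flatten_mapP => i; rewrite mem_iota mem_cat !mem_nseq => im.
  by case/orP => /andP[_ /eqP ->]; lia.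
have := pairwise_labels m k l; have := map_odd_labels s_run.
case: (labels m k l) tm => //= x r tm; rewrite /J_dim /I_s1 => <- /=.
case/andP => /allP rx _; have := tm x (mem_head _ _).
rewrite inE => xm /predU1P[->|/rx /= px]; last apply: (leq_trans px).
all: by case: (odd x) (odd_double_half x) => /=; lia.
Qed.

Lemma sum_count_true s m k l :
  run_form s m k l -> (\sum_(1 <= i < m.+1) k i)%N = count_mem true s.
Proof.
case=> _ _ _ ->; rewrite count_flatten sumnE !big_map /index_iota subn1.
by apply: eq_bigr => i _; rewrite count_cat !count_nseq mul1n addn0.
Qed.

Lemma sum_count_false s m k l :
  run_form s m k l -> (\sum_(1 <= i < m.+1) l i)%N = count_mem false s.
Proof.
case=> _ _ _ ->; rewrite count_flatten sumnE !big_map /index_iota subn1.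
by apply: eq_bigr => i _; rewrite count_cat !count_nseq mul1n mul0n.
Qed.

(** * Positivity of the run lengths [a_p] *)

Section RunForm.
Variables (s : seq bool) (m : nat) (k l : nat -> nat).
Hypothesis s_run : run_form s m k l.
Hypothesis s_size : (2 <= size s)%N.
Hypothesis s01 : nth false s 0 = nth false s 1.

(** For [J > 0], [a_J] is the length of the first nonempty run, and equality of the first two
    letters makes it at least 2. *)
Lemma a_seq_last : (0 < J_dim m s)%N -> (1 < a_seq m k l (J_dim m s))%N.
Proof.
have [m0 k0 l0 sE] := s_run; rewrite /J_dim /I_s1.
case: m m0 k0 l0 sE => [//|m'] _ k0 l0 /= sE.
have ak : a_seq m'.+1 k l (2 * (m'.+1 - 1) + true) = k 1%N.
  by rewrite /a_seq ifT; [congr k; lia|lia].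
have al : (0 < m')%N -> a_seq m'.+1 k l (2 * (m'.+1 - 1) + false) = l 1%N.
  by move=> m0; rewrite /a_seq ifF; [congr l; lia|lia].
move: s01 s_size; rewrite sE.
case k1: (k 1%N) => [|[|k1']] /=; last by rewrite ak k1.
  case l1: (l 1%N) => [|[|l1']] /=; last first.
  - by move=> _ _ J0; rewrite al ?l1 //; lia.
  - case: m' {sE ak al} k0 l0 => //= m' k0 l0.
    by have := k0 2%N isT; case: (k 2%N).
  case: m' {sE ak al} k0 l0 => //= m' k0 l0.
  by have := l0 1%N isT; rewrite l1.
case: m' {sE al} k0 l0 ak => [|m'] /= k0 l0 ak.
  by rewrite cats0; case: (l 1%N).
by have := l0 1%N isT; case: (l 1%N).
Qed.

Lemma a_seq_gt0 p : (0 < p <= J_dim m s)%N -> (0 < a_seq m k l p)%N.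
Proof.
case/andP => p0; rewrite leq_eqVlt => /predU1P[pJ|pJ].
  by rewrite pJ ltnW // a_seq_last // -pJ.
have [m0 k0 l0 _] := s_run; move: pJ; rewrite /J_dim /I_s1 /a_seq => pJ.
by case: ifP => op; [apply: k0|apply: l0]; lia.
Qed.

End RunForm.

(** * Excluding the eigenvalues 0 and -1 *)

Section Nonsingular.
Variables (R : realType) (m J : nat) (k l : nat -> nat).
Hypothesis a_gt0 : forall p, (0 < p <= J)%N -> (0 < a_seq m k l p)%N.
Hypothesis a_last : (0 < J)%N -> (1 < a_seq m k l J)%N.

(* Both [0] and [-1] make the coefficient [x + odd p] vanish for every other
   [p].  For a left eigenvector [v] and [y := v C] with
   [C p q := odd (minn p q)], so that [y_q a_q = (x + odd q) v_q], this kills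
   every other [y_q]; as [y_(q+1) - y_q] is, up to sign, the tail sum
   [\sum_(p > q) v_p], consecutive tail sums agree and all of [y] vanishes. *)
Lemma eigenvalue_B_N1_0 (b : bool) : ~~ eigenvalue (B_mx m k l R J) (- b%:R).
Proof.
apply/negP => /eigenvalueP[v vB /negP]; apply.
pose y q := \sum_(i < J) v 0 i * (odd (minn i.+1 q))%:R.
pose V q := \sum_(i < J | (q <= i)%N) v 0 i.
have y0 : y 0%N = 0.
  by rewrite /y big1 // => i _; rewrite minn0 mulr0.
have VJ : V J = 0.
  by rewrite /V big1 // => i; rewrite leqNgt ltn_ord.
have yS q : y q.+1 - y q = (-1) ^+ q * V q.
  rewrite -sumrB /V mulr_sumr [RHS]big_mkcond; apply: eq_bigr => i _.
  rewrite minnSS -signr_odd; case: ifPn => [qi|]; last rewrite -ltnNge => iq.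
    rewrite (minn_idPr qi) (minn_idPr (leqW qi)) /=.
    by case: (odd q) => /=; rewrite ?expr0 ?expr1; ring.
  by rewrite (minn_idPl iq) (minn_idPl (ltnW iq)) subrr.
have VS (q : 'I_J) : V q = v 0 q + V q.+1.
  rewrite /V (bigD1 q) //=; congr (_ + _); apply: eq_bigl => i.
  by rewrite ltn_neqAle andbC eq_sym.
have yv (q : 'I_J) :
    y q.+1 * (a_seq m k l q.+1)%:R = ((odd q.+1)%:R - b%:R) * v 0 q.
  have /matrixP/(_ 0 q) := vB; rewrite !mxE mulrBl -mulNr => <-.
  under [X in _ = _ + X]eq_bigr do rewrite mxE B_entryE mulrBr mulrA.
  rewrite sumrB mulr_suml addrCA -[LHS]addr0; congr (_ + _).
  rewrite (bigD1 q) //= eqxx mulrC big1 ?addr0 ?subrr // => i.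
  by rewrite eqSS val_eqE => /negPf ->; rewrite mulr0.
have a_neq0 (q : 'I_J) : (a_seq m k l q.+1)%:R != 0 :> R.
  by rewrite pnatr_eq0 -lt0n a_gt0 //=.
have y_par q : (q <= J)%N -> odd q = b -> y q = 0.
  case: q => // q qJ qb; have := yv (Ordinal qJ); rewrite /= -qb subrr mul0r.
  by move/eqP; rewrite mulf_eq0 (negPf (a_neq0 (Ordinal qJ))) orbF => /eqP.
have y_eq0 q : (q <= J)%N -> y q = 0.
  case: q => // q qJ; have [/eqP/y_par->//|qb] := boolP (odd q.+1 == b).
  have odd_q : odd q = b by move: qb; rewrite /=; case: (odd q); case: (b).
  have yq : y q = 0 by apply: y_par => //; exact: ltnW.
  have yVq := yS q; rewrite yq subr0 in yVq.
  (* At the last label, [V J = 0] gives [V q = v_q], so the eigenvector equation reads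
     [y_J a_J = y_J], and [a_J > 1] forces [y_J = 0]. *)
  move: qJ; rewrite leq_eqVlt => /predU1P[qJ|qJ].
    have J0 : (0 < J)%N by rewrite -qJ.
    have a1 : (a_seq m k l q.+1)%:R != 1 :> R.
      by rewrite pnatr_eq1 qJ neq_ltn a_last ?orbT.
    have q'J : (q < J)%N by rewrite -qJ.
    have := yv (Ordinal q'J); have := VS (Ordinal q'J); rewrite /= qJ VJ addr0 => Vq.
    have -> : (~~ odd q)%:R - b%:R = (-1) ^+ q :> R.
      by rewrite -signr_odd odd_q; case: (b) => /=; rewrite ?subr0 ?sub0r.
    rewrite -Vq -qJ -yVq => /eqP; rewrite -subr_eq0 -[X in _ - X]mulr1 -mulrBr.
    by rewrite mulf_eq0 subr_eq0 (negPf a1) orbF => /eqP.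
  (* Otherwise both neighbours of [q.+1] have the parity of [b], so [y] vanishes there; equal tail
     sums give a zero entry of [v], hence a zero of [y]. *)
  have yq2 : y q.+2 = 0.
    by apply: y_par => //=; rewrite negbK.
  have := yS q.+1; rewrite yq2 sub0r exprS mulN1r mulNr yVq => /oppr_inj.
  move/(mulfI (negbT (signr_eq0 _ _))) => VV.
  have q'J := ltnW qJ.
  have v0 : v 0 (Ordinal q'J) = 0.
    by apply: (addIr (V q.+1)); rewrite add0r -(VS (Ordinal q'J)).
  have /eqP := yv (Ordinal q'J); rewrite v0 mulr0 mulf_eq0 -yVq.
  by rewrite (negPf (a_neq0 _)) orbF => /eqP.
have V0 q : (q <= J)%N -> V q = 0.
  rewrite leq_eqVlt => /predU1P[->//|qJ].
  have := yS q; rewrite !y_eq0 ?(ltnW qJ) // subrr => /esym/eqP.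
  by rewrite mulf_eq0 signr_eq0 => /eqP.
apply/eqP/rowP => q; rewrite mxE.
by have := VS q; rewrite !V0 ?ltn_ord ?(ltnW (ltn_ord q)) // addr0.
Qed.

End Nonsingular.

(** * Multiplicities and the spectral distribution *)

Lemma sum_bool_seq (V : nmodType) (F : bool -> V) (s : seq bool) :
  \sum_(b <- s) F b = F true *+ count_mem true s + F false *+ count_mem false s.
Proof.
elim: s => [|b s IH]; first by rewrite big_nil !mulr0n addr0.
by rewrite big_cons IH; case: b => /=; rewrite add0n add1n mulrS;
  [exact: addrA | exact: addrCA].
Qed.

Lemma sum_odd_alt (V : nmodType) (F : bool -> V) r (b : bool) :
  \sum_(q <- iota 0 (2 * r + b)) F (odd q.+1) = F true *+ (r + b) + F false *+ r.
Proof.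
have E : \sum_(q <- iota 0 (2 * r)) F (odd q.+1) = F true *+ r + F false *+ r.
  elim: r => [|r IH]; first by rewrite muln0 big_nil !mulr0n addr0.
  rewrite mulnS addnC addn2 -[X in iota 0 X]addn2 iotaD big_cat IH /= !big_cons.
  rewrite big_nil addr0 add0n /= mul2n odd_double /=.
  by rewrite !mulrSr addrACA.
rewrite iotaD big_cat E add0n; case: b => /=; last by rewrite big_nil !addr0 addn0.
by rewrite big_cons big_nil addr0 /= mul2n odd_double /= addn1 mulrSr addrAC.
Qed.

(** Solves the balance for [x]; [0 < m] reconciles truncated [m - 1] with the integer subtraction in
    [C_m1] and [C_0]. *)
Lemma counts_balance (R : realDomainType) (K L m i : nat) (x y u v : R) :
  (0 < m)%N ->
  x + (u *+ (m - 1 + i) + v *+ (m - 1)) = u *+ K + v *+ L + y ->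
  x = (K%:Z - (m%:Z - 1) - i%:Z)%:~R * u + (L%:Z - (m%:Z - 1))%:~R * v + y.
Proof.
case: m => // m _; rewrite subSS subn0 -addn1 PoszD addrK !intrB /= -!pmulrn.
rewrite -!(mulr_natr u) -!(mulr_natr v) natrD => E; lra.
Qed.

Section Spectrum.
Variables (R : realType) (n : nat) (s : n.-tuple bool) (m : nat) (k l : nat -> nat).
Hypothesis n_ge2 : (2 <= n)%N.
Hypothesis s01 : nth false s 0 = nth false s 1.
Hypothesis s_run : run_form s m k l.

Let J := J_dim m s.
Let B := B_mx m k l R J.
Let A := adjacency R (threshold_graph s).

Lemma perm_eigenvalues :
  perm_eq (eigenvalues A ++ [seq - (odd q.+1)%:R | q <- iota 0 J])
          ([seq - (b : bool)%:R | b <- s] ++ eigenvalues B).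
Proof.
have sz : size (labels m k l) == n.
  by rewrite -(size_map odd) (map_odd_labels s_run) size_tuple.
pose t : n.-tuple nat := Tuple sz.
have s_odd i : tnth s i = odd (tnth t i).
  rewrite (tnth_nth false) (tnth_nth 0%N) -(nth_map 0%N false) ?(eqP sz) //=.
  by rewrite (map_odd_labels s_run).
have t_sorted (i j : 'I_n) : (i < j)%N -> (tnth t j <= tnth t i)%N.
  move=> ij; rewrite !(tnth_nth 0%N) /=.
  by apply: (pairwiseP 0%N (pairwise_labels m k l)); rewrite // inE (eqP sz).
have t_le i : (tnth t i <= J)%N.
  by apply: (labels_le s_run); exact: (mem_tnth i t).
have count_t p : (0 < p <= J)%N -> count_mem p t = a_seq m k l p.
  move=> /andP[p0 pJ]; apply: count_labels; rewrite p0 (leq_ltn_trans pJ) //.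
  rewrite /J /J_dim /I_s1; have [m0 _ _ _] := s_run.
  by case: (nth _ _ _) => /=; lia.
have /(congr1 (map_poly (real_complex R))) :=
  threshold_char_poly R s_odd t_sorted t_le count_t.
rewrite !rmorphM !rmorph_prod /= !eigenvaluesP => E.
have root_ofE (b : bool) : map_poly (real_complex R) ('X - (- b%:R)%:P) =
    'X - (- b%:R)%:P.
  by rewrite map_polyXsubC rmorphN rmorph_nat.
(* Over [R[i]] both sides are products of monic linear factors, so unique factorisation gives
   equality of root multisets. *)
apply: prod_XsubC_eq; rewrite !big_cat !big_map /= mulrC [in RHS]big_tuple.
have -> : iota 0 J = index_iota 0 J by rewrite /index_iota subn0.
rewrite big_mkord.
apply: (etrans _ (etrans E _)); congr (_ * _); apply: eq_bigr => i _.
  by rewrite root_ofE.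
exact: root_ofE.
Qed.

(** [B] need not be symmetric; reality is inherited from the adjacency matrix through
    [perm_eigenvalues]. *)
Lemma eigenvalues_B_real (z : R[i]) : z \in eigenvalues B -> z \is Num.real.
Proof.
move=> zB; have : z \in [seq - (b : bool)%:R | b <- s] ++ eigenvalues B.
  by rewrite mem_cat zB orbT.
rewrite -(perm_mem perm_eigenvalues) mem_cat => /orP[/tnthP[i ->]|/mapP[q _ ->]].
  exact: adjacency_eigenvalues_real.
by rewrite rpredN realn.
Qed.

Lemma eigenvalues_B_neq (b : bool) : - b%:R \notin eigenvalues B.
Proof.
have s2 : (2 <= size s)%N by rewrite size_tuple.
rewrite -root_prod_XsubC -eigenvaluesP -[b%:R](rmorph_nat (real_complex R)).
rewrite -rmorphN fmorph_root -eigenvalue_root_char.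
apply: eigenvalue_B_N1_0 => [p|]; first exact: (a_seq_gt0 s_run).
exact: (a_seq_last s_run).
Qed.

(** Labels [1..J] include [m - 1 + I_s1 s] odd and [m - 1] even ones; subtracting these from the
    numbers of ones and zeros in [s] leaves [C_m1] and [C_0]. *)
Lemma sum_eigenvalues (f : R[i] -> R) :
  \sum_(z <- eigenvalues A) f z = (C_m1 m k s)%:~R * f (-1) + (C_0 m l)%:~R * f 0
     + \sum_(z <- eigenvalues B) f z.
Proof.
have := perm_big _ perm_eigenvalues (op := +%R) (P := xpredT) (F := f) => /(_ 0).
rewrite !big_cat !big_map /= (sum_bool_seq (fun b => f (- b%:R))).
rewrite (sum_odd_alt (fun b => f (- b%:R))) -(sum_count_true s_run).
rewrite -(sum_count_false s_run) oppr0; have [m0 _ _ _] := s_run.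
exact: counts_balance.
Qed.

End Spectrum.

Theorem theorem1 (R : realType) (n : nat) (s : n.-tuple bool)
    (m : nat) (k l : nat -> nat) :
  (2 <= n)%N ->
  nth false s 0 = nth false s 1 ->
  run_form s m k l ->
  let J := J_dim m s in
  let lambda := tnth (eigenvalues (B_mx m k l R J)) in
  [/\ forall j : 'I_J, lambda j \is Num.real,
      forall A : set R, measurable A ->
        spectral_distribution R (threshold_graph s) A =
          (((C_m1 m k s)%:~R / n%:R)%:E * \d_((-1)%R : R) A
           + ((C_0 m l)%:~R / n%:R)%:E * \d_(0%R : R) A
           + (n%:R^-1)%:E * \sum_(j < J) \d_(complex.Re (lambda j)) A)%E
    & forall j : 'I_J, lambda j != 0 /\ lambda j != -1].
Proof.
move=> n2 s01 s_run J lambda; split=> [j|A _|j].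
- by apply: (eigenvalues_B_real n2 s01 s_run); exact: mem_tnth.
(* Testing the eigenvalue sums against the indicator of [A] turns them into values of sums of Dirac
   measures. *)
- have := sum_eigenvalues (R := R) n2 s01 s_run (fun z => \1_A (complex.Re z)).
  rewrite !big_tuple => E.
  have -> : spectral_distribution R (threshold_graph s) A =
      (n%:R^-1 * \sum_(i < n) \1_A (complex.Re (tnth
        (eigenvalues (adjacency R (threshold_graph s))) i)))%:E.
    rewrite EFinM -sumEFin /spectral_distribution /= /mscale /= /msum.
    by congr (_ * _)%E; apply: eq_bigr => i _; rewrite (tnth_nth 0).
  rewrite /dirac !sumEFin -!EFinM -!EFinD E !mulrDr !mulrA.
  by rewrite ![n%:R^-1 * _]mulrC.
- split; apply/negP => /eqP lj.
    have := eigenvalues_B_neq R n2 s01 s_run false.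
    by rewrite oppr0 -lj mem_tnth.
  have := eigenvalues_B_neq R n2 s01 s_run true.
  by rewrite -lj mem_tnth.
Qed.
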